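(* Let $M = T^*\mathbb{R}^2 \cong \mathbb{R}^4$ with Darboux coordinates $(q^1,q^2,p_1,p_2)$, let $r^2 = (q^1)^2+(q^2)^2$, and let $M_{\mathrm{sing}} = T^*_0\mathbb{R}^2 = \{q^1=q^2=0\}$. Consider the closed 2-form on $M\setminus M_{\mathrm{sing}}$ $$\omega = dq^1\wedge dp_1 + dq^2\wedge dp_2 + r^{-2}\,dq^1\wedge dq^2$$ (the magnetic symplectic form of a magnetic monopole in 2 dimensions). Then the Dirac structure $\mathrm{Graph}(\omega) = \{X + i_X\omega \mid X\in T(M\setminus M_{\mathrm{sing}})\}$ extends smoothly to a Dirac structure on $M = T^*\mathbb{R}^2$, i.e. there is a Dirac structure $L\subset TM\oplus T^*M$ over all of $M$ whose restriction to $M\setminus M_{\mathrm{sing}}$ is $\mathrm{Graph}(\omega)$.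
   Context: A Dirac structure on a manifold $M$ is a smooth vector subbundle $L\subset TM\oplus T^*M$ that is maximally isotropic with respect to the symmetric pairing $\langle X+\alpha, Y+\beta\rangle_+ = \tfrac12(i_X\beta + i_Y\alpha)$ and whose sections are closed under the Dorfman bracket $[X+\alpha,Y+\beta] = [X,Y] + \mathcal{L}_X\beta - i_Y d\alpha$. *)

(* Defs.v *)
From HB Require Import structures.
From mathcomp Require Import all_boot all_order all_algebra.
From mathcomp Require Import all_classical all_reals all_analysis.
Import Order.TTheory GRing.Theory Num.Theory.
Import numFieldNormedType.Exports.

Set Implicit Arguments.
Unset Strict Implicit.
Unset Printing Implicit Defensive.

Local Open Scope classical_set_scope.
Local Open Scope ring_scope.

(* Geometry on open subsets U of R^n. The tangent and cotangent spaces at a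
   point are both 'rV[R]_n, in the coordinates given by d/dx^i and dx^i.
   Fields and forms are total functions on R^n of which only the restriction
   to U is meaningful; as U is open, derivatives at points of U depend on
   that restriction only. *)

Fixpoint Ck_on (R : realType) (n : nat) (W : normedModType R) (k : nat)
    (U : set 'rV[R]_n) (f : 'rV[R]_n -> W) : Prop :=
  match k with
  | 0%N => forall x, U x -> {for x, continuous f}
  | k'.+1 => (forall x, U x -> differentiable f x) /\
             (forall v : 'rV[R]_n, Ck_on k' U (fun x => 'D_v f x))
  end.

Definition smooth_on (R : realType) (n : nat) (W : normedModType R)
    (U : set 'rV[R]_n) (f : 'rV[R]_n -> W) : Prop :=
  forall k, Ck_on k U f.

Section Dirac.
Variables (R : realType) (n : nat).

Local Notation V := ('rV[R]_n).
Local Notation T2 := ('rV[R]_n * 'rV[R]_n)%type.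

Implicit Types (x : V) (X Y al be : V -> V) (a b : V -> T2).

(* The value of the covector al at the vector u. *)
Definition ev (u al : V) : R := (u *m al^T) 0 0.

Definition pairing (s t : T2) : R := 2^-1 * (ev s.1 t.2 + ev t.1 s.2).

Definition isotropic (W : {vspace T2}) : Prop :=
  forall s t, s \in W -> t \in W -> pairing s t = 0.

Definition max_isotropic (W : {vspace T2}) : Prop :=
  isotropic W /\
  forall W' : {vspace T2}, isotropic W' -> (W <= W')%VS -> W' = W.

Definition smooth_subbundle (U : set V) (L : V -> {vspace T2}) : Prop :=
  exists k : nat, forall x, U x ->
    exists (N : set V) (e : 'I_k -> V -> T2),
      [/\ open N, N x, N `<=` U,
          forall i, smooth_on N (e i) &
          forall y, N y -> basis_of (L y) [seq e i y | i : 'I_k]].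

Definition is_section (U : set V) (L : V -> {vspace T2})
    (s : V -> T2) : Prop :=
  smooth_on U s /\ forall x, U x -> s x \in L x.

Definition lie_bracket X Y : V -> V :=
  fun x => 'D_(X x) Y x - 'D_(Y x) X x.

(* (d al)(u, v) for constant vector fields u and v, which commute. *)
Definition d1 al x (u v : V) : R := ev v ('D_u al x) - ev u ('D_v al x).

(* i_Y (d al), as a covector *)
Definition contract_d1 Y al : V -> V :=
  fun x => \row_j d1 al x (Y x) (delta_mx 0 j).

(* (L_X be)_j = X(be_j) + be(d_j X), which is X(be(e_j)) - be([X, e_j])
   for the j-th coordinate vector field e_j. *)
Definition lie_deriv1 X be : V -> V :=
  fun x => \row_j (ev (delta_mx 0 j) ('D_(X x) be x)
                   + ev ('D_(delta_mx 0 j) X x) (be x)).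

Definition dorfman a b : V -> T2 :=
  let X := fun x => (a x).1 in let al := fun x => (a x).2 in
  let Y := fun x => (b x).1 in let be := fun x => (b x).2 in
  fun x => (lie_bracket X Y x, lie_deriv1 X be x - contract_d1 Y al x).

Definition dirac_structure (U : set V) (L : V -> {vspace T2}) : Prop :=
  [/\ smooth_subbundle U L,
      forall x, U x -> max_isotropic (L x) &
      forall a b, is_section U L a -> is_section U L b ->
                  is_section U L (dorfman a b)].

(* The 2-form om at x is (u, v) |-> u (om x) v^T, so that the covector
   i_u om = om(u, .) is the row vector u (om x). *)
Definition wedge (al be : V) : 'M[R]_n := al^T *m be - be^T *m al.

Definition two_form (U : set V) (om : V -> 'M[R]_n) : Prop :=
  smooth_on U om /\
  forall x, U x -> forall u : V, (u *m om x *m u^T) 0 0 = 0.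

Definition d2 (om : V -> 'M[R]_n) x (u v w : V) : R :=
  (v *m 'D_u om x *m w^T) 0 0 - (u *m 'D_v om x *m w^T) 0 0
  + (u *m 'D_w om x *m v^T) 0 0.

Definition closed_two_form (U : set V) (om : V -> 'M[R]_n) : Prop :=
  two_form U om /\ forall x, U x -> forall u v w : V, d2 om x u v w = 0.

Definition graph (om : V -> 'M[R]_n) : V -> {vspace T2} :=
  fun x => limg (linfun (fun u : V => (u, u *m om x))).

Lemma mem_graph (om : V -> 'M[R]_n) x (s : T2) :
  (s \in graph om x) = (s.2 == s.1 *m om x).
Proof.
have lin : linear (fun u : V => (u, u *m om x) : T2).
  by move=> c u v; rewrite mulmxDl -scalemxAl.
pose f := GRing.isLinear.Build _ _ _ _ (fun u : V => (u, u *m om x) : T2) lin.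
pose F : {linear V -> T2} := HB.pack (fun u : V => (u, u *m om x) : T2) f.
apply/idP/eqP => [/memv_imgP[u _ ->]|sE].
  by rewrite (lfunE F).
apply/memv_imgP; exists s.1; first exact: memvf.
by rewrite (lfunE F) /= -sE -surjective_pairing.
Qed.

End Dirac.

(* R^4 = T^*R^2 with coordinates (q^1, q^2, p_1, p_2) at indices 0, 1, 2, 3. *)
Definition iq1 : 'I_4 := @Ordinal 4 0 isT.
Definition iq2 : 'I_4 := @Ordinal 4 1 isT.
Definition ip1 : 'I_4 := @Ordinal 4 2 isT.
Definition ip2 : 'I_4 := @Ordinal 4 3 isT.

Definition dx (R : realType) (i : 'I_4) : 'rV[R]_4 := delta_mx 0 i.

Definition r2 (R : realType) (x : 'rV[R]_4) : R := x 0 iq1 ^+ 2 + x 0 iq2 ^+ 2.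

Definition Msing (R : realType) : set 'rV[R]_4 :=
  [set x | x 0 iq1 = 0 /\ x 0 iq2 = 0].

(* On Msing, where the form is not defined, (r2 x)^-1 is 0 by convention. *)
Definition omega (R : realType) (x : 'rV[R]_4) : 'M[R]_4 :=
  wedge (dx R iq1) (dx R ip1) + wedge (dx R iq2) (dx R ip2)
  + (r2 x)^-1 *: wedge (dx R iq1) (dx R iq2).

(* Main.v *)
(* Write X = (X_q, X_p), al = (al_q, al_p), and J for the rotation of R^2 by a
   right angle. Off Msing the graph of omega is
     al_p = X_q,   al_q = r^-2 X_q J - X_p.
   With X_q = r^2 Y this becomes X = (r^2 Y, X_p), al = (Y J - X_p, r^2 Y),
   which is polynomial in the base point and injective in (Y, X_p) even where
   r = 0, so its image is a smooth rank 4 bundle on all of R^4. Equivalently the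
   bundle is cut out by al_p = X_q and X_q J = r^2 (al_q + X_p), so that its
   sections satisfy the differentiated equations too; with d(r^2)/dp = 0 these
   turn involutivity into a polynomial identity in the components of two
   sections and their first partial derivatives, valid on any open set. *)
From HB Require Import structures.
Require Import Defs.
From mathcomp Require Import all_boot all_order all_algebra.
From mathcomp Require Import all_classical all_reals all_analysis.
From mathcomp Require Import ring lra.
Import Order.TTheory GRing.Theory Num.Theory.
Import numFieldNormedType.Exports.

Set Implicit Arguments.
Unset Strict Implicit.
Unset Printing Implicit Defensive.

Local Open Scope classical_set_scope.
Local Open Scope ring_scope.

(** * Differentiability under local equality, and the standard basis *)

Lemma near_eq_differentiable (K : numFieldType) (V W : normedModType K)
    (f g : V -> W) (x : V) :
  {near x, f =1 g} -> differentiable f x -> differentiable g x.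
Proof.
move=> fg df; have fgx : f x = g x := nbhs_singleton fg.
have dfc := diff_continuous df.
(* The first-order expansion of [f] at [x] is also one for [g], because the two agree near [x];
   uniqueness of the differential then gives ['d g x = 'd f x]. *)
have dg : g \o shift x = cst (g x) + 'd f x +o_ 0 id.
  apply/eqaddoP => e e0.
  have /eqaddoP/(_ e e0) := diff_locally df.
  have fg0 : \forall h \near (0 : V), f (h + x) = g (h + x).
    by rewrite (near_shift x) sub0r; apply: filterS fg => y /=; rewrite subrK.
  apply: filterS2 fg0 => h /= fgh.
  by rewrite !fctE /= fgh fgx.
apply/diff_locallyP; rewrite (diff_unique dfc dg).
by split.
Qed.

Lemma basis_of_delta (F : fieldType) p :
  basis_of fullv [seq (delta_mx 0 i : 'rV[F]_p) | i : 'I_p].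
Proof.
rewrite basisEdim size_map -cardE card_ord dimvf /dim /= mul1n leqnn andbT.
apply/subvP => u _; rewrite (row_sum_delta u); apply: memv_suml => i _.
by apply: memvZ; apply: memv_span; apply: map_f; rewrite mem_enum.
Qed.

(** * Calculus of C^k functions on an open set *)

Section smooth_calculus.
Variables (R : realType) (n : nat).
Implicit Types (W : normedModType R) (U : set 'rV[R]_n) (k : nat).

Lemma open_near_eq {T : Type} U (f g : 'rV[R]_n -> T) x :
  open U -> (forall x, U x -> f x = g x) -> U x -> \near x, f x = g x.
Proof.
move=> oU fg Ux; apply: filterS (open_nbhs_nbhs (conj oU Ux)) => y; exact: fg.
Qed.

(** Openness of [U] turns equality on [U] into equality near each of its points, which survives
    differentiation. This allows a derivative to be replaced by a formula that is valid on [U]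
    only. *)
Lemma Ck_on_ext W k U (f g : 'rV[R]_n -> W) :
  open U -> (forall x, U x -> f x = g x) -> Ck_on k U f -> Ck_on k U g.
Proof.
move=> oU; elim: k f g => [|k IH] f g fg /=.
  move=> cf x Ux; apply: cvg_trans (near_eq_cvg (open_near_eq oU fg Ux)) _.
  by rewrite -fg//; exact: cf.
move=> [df cf]; split=> [x Ux|v].
  by apply: near_eq_differentiable (df _ Ux); exact: open_near_eq Ux.
apply: IH (cf v) => x Ux; apply: near_eq_derive; exact: open_near_eq Ux.
Qed.

Lemma Ck_on_differentiable W k U (f : 'rV[R]_n -> W) x :
  Ck_on k.+1 U f -> U x -> differentiable f x.
Proof. by case=> df _; exact: df. Qed.

Lemma Ck_onW W k U (f : 'rV[R]_n -> W) : Ck_on k.+1 U f -> Ck_on k U f.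
Proof.
elim: k f => [|k IH] f [df cf] /=.
  by move=> x Ux; exact/differentiable_continuous/df.
by split=> // v; exact: IH.
Qed.

Lemma Ck_on_cst W k U (c : W) : Ck_on k U (fun=> c : W).
Proof.
elim: k c => [|k IH] c /=; first by move=> x _; exact: cst_continuous.
split=> [x _|v]; first exact: differentiable_cst.
have -> : (fun x => 'D_v (fun=> c) x) = fun=> 0.
  by apply/funext => x; exact: derive_cst.
exact: IH.
Qed.

Lemma derive_linear_comp W W' (l : {linear W -> W'}) (f : 'rV[R]_n -> W) x v :
  continuous l -> differentiable f x ->
  'D_v (fun y => l (f y)) x = l ('D_v f x).
Proof.
move=> cl df.
have dl : differentiable l (f x) by exact: linear_differentiable.
rewrite (deriveE _ df) deriveE; last exact: differentiable_comp.
by rewrite (diff_comp df) // diff_lin.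
Qed.

Lemma Ck_on_linear_comp W W' (l : {linear W -> W'}) k U (f : 'rV[R]_n -> W) :
  open U -> continuous l -> Ck_on k U f -> Ck_on k U (fun y => l (f y)).
Proof.
move=> oU cl; elim: k f => [|k IH] f /=.
  by move=> cf x Ux; apply: continuous_comp; [exact: cf | exact: cl].
move=> [df cf]; split=> [x Ux|v].
  apply: differentiable_comp; first exact: df.
  exact: linear_differentiable.
apply: Ck_on_ext (IH _ (cf v)) => // x Ux.
by rewrite derive_linear_comp//; exact: df.
Qed.

(** A directional derivative of a linear map is constant, so a case split on [k] replaces
    induction. *)
Lemma Ck_on_linear W (l : {linear 'rV[R]_n -> W}) k U :
  continuous l -> Ck_on k U l.
Proof.
move=> cl; case: k => [|k] /=; first by move=> x _; exact: cl.
split=> [x _|v]; first exact: linear_differentiable.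
have -> : (fun x => 'D_v l x) = fun=> l v; last exact: Ck_on_cst.
apply/funext => x; rewrite deriveE ?diff_lin //.
exact: linear_differentiable.
Qed.

Lemma Ck_onD W k U (f g : 'rV[R]_n -> W) : open U ->
  Ck_on k U f -> Ck_on k U g -> Ck_on k U (f + g).
Proof.
move=> oU; elim: k f g => [|k IH] f g /=.
  by move=> cf cg x Ux; apply: continuousD; [exact: cf | exact: cg].
move=> [df cf] [dg cg]; split=> [x Ux|v].
  by apply: differentiableD; [exact: df | exact: dg].
apply: Ck_on_ext (IH _ _ (cf v) (cg v)) => // x Ux.
by rewrite deriveD; [|exact/diff_derivable/df|exact/diff_derivable/dg].
Qed.

Lemma Ck_onB W k U (f g : 'rV[R]_n -> W) : open U ->
  Ck_on k U f -> Ck_on k U g -> Ck_on k U (f - g).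
Proof.
move=> oU cf cg; apply: Ck_onD => //.
apply: (@Ck_on_linear_comp _ _ -%R) cg => //; exact: opp_continuous.
Qed.

Lemma Ck_on_sum W (I : Type) (r : seq I) k U (f : I -> 'rV[R]_n -> W) :
  open U -> (forall i, Ck_on k U (f i)) -> Ck_on k U (\sum_(i <- r) f i).
Proof.
move=> oU cf; apply: big_ind => //; first exact: Ck_on_cst.
by move=> g h; exact: Ck_onD.
Qed.

Lemma Ck_onM k U (f g : 'rV[R]_n -> R) : open U ->
  Ck_on k U f -> Ck_on k U g -> Ck_on k U (f * g).
Proof.
move=> oU; elim: k f g => [|k IH] f g.
  by move=> cf cg x Ux; apply: continuousM; [exact: cf | exact: cg].
move=> Cf Cg; have [df cf] := Cf; have [dg cg] := Cg; split=> [x Ux|v].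
  by apply: differentiableM; [exact: df | exact: dg].
apply: Ck_on_ext (Ck_onD _ (IH _ _ (Ck_onW Cf) (cg v))
  (IH _ _ (Ck_onW Cg) (cf v))) => // x Ux.
by rewrite deriveM; [|exact/diff_derivable/df|exact/diff_derivable/dg].
Qed.

(** Induction on [k] with [f] fixed: the derivative of 1/f is -(1/f)(1/f) Df, a product of functions
    that are C^k by the induction hypothesis and by the assumption on [f]. *)
Lemma Ck_onV k U (f : 'rV[R]_n -> R) : open U ->
  (forall x, U x -> f x != 0) ->
  Ck_on k U f -> Ck_on k U (fun x => (f x)^-1).
Proof.
move=> oU f0; elim: k => [|k IH].
  by move=> cf x Ux; apply: continuousV; [exact: f0 | exact: cf].
move=> Cf; have [df cf] := Cf; split=> [x Ux|v].
  by apply: differentiableV; [exact: df | exact: f0].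
have CV := IH (Ck_onW Cf).
have CN : Ck_on k U (fun=> -1 : R) by exact: Ck_on_cst.
have := Ck_onM oU (Ck_onM oU CN (Ck_onM oU CV CV)) (cf v).
apply: Ck_on_ext => // x Ux.
rewrite deriveV; [|exact: f0|exact/diff_derivable/df].
by rewrite !fctE /= mulN1r expr2 invfM.
Qed.

End smooth_calculus.

(** * Smoothness through components *)

Section coordinates.
Variables (R : realType) (n : nat).
Implicit Types (U : set 'rV[R]_n) (k : nat).
Local Notation V := 'rV[R]_n.
Local Notation e := (fun i => delta_mx 0 i : V).

(** The linear structure is packed inside the proof, so that [l] may be a bare function such as a
    projection or a coordinate. *)
Lemma Ck_on_lin_comp (W W' : normedModType R) (l : W -> W') k U (f : V -> W) :
  linear l -> open U -> continuous l -> Ck_on k U f ->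
  Ck_on k U (fun y => l (f y)).
Proof.
move=> lin.
pose m := GRing.isLinear.Build _ _ _ _ l lin.
pose L : {linear W -> W'} := HB.pack l m.
exact: (@Ck_on_linear_comp _ _ _ _ L).
Qed.

Lemma derive_lin_comp (W W' : normedModType R) (l : W -> W') (f : V -> W) x v :
  linear l -> continuous l -> differentiable f x ->
  'D_v (fun y => l (f y)) x = l ('D_v f x).
Proof.
move=> lin.
pose m := GRing.isLinear.Build _ _ _ _ l lin.
pose L : {linear W -> W'} := HB.pack l m.
exact: (@derive_linear_comp _ _ _ _ L).
Qed.

Lemma Ck_on_scalel (W : normedModType R) k U (f : V -> R) (w : W) : open U ->
  Ck_on k U f -> Ck_on k U (fun y => f y *: w).
Proof.
move=> oU; apply: (@Ck_on_lin_comp R W (fun c => c *: w)) => //.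
- by move=> c a b; rewrite scalerDl scalerA.
- exact: scalel_continuous.
Qed.

Lemma Ck_on_fst (W W' : normedModType R) k U (f : V -> W * W') : open U ->
  Ck_on k U f -> Ck_on k U (fun y => (f y).1).
Proof.
move=> oU; apply: (@Ck_on_lin_comp (W * W')%type W fst) => // x.
exact: cvg_fst.
Qed.

Lemma Ck_on_snd (W W' : normedModType R) k U (f : V -> W * W') : open U ->
  Ck_on k U f -> Ck_on k U (fun y => (f y).2).
Proof.
move=> oU; apply: (@Ck_on_lin_comp (W * W')%type W' snd) => // x.
exact: cvg_snd.
Qed.

Lemma Ck_on_pair (W W' : normedModType R) k U (f : V -> W) (g : V -> W') :
  open U -> Ck_on k U f -> Ck_on k U g -> Ck_on k U (fun y => (f y, g y)).
Proof.
move=> oU cf cg.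
(* The pair is the sum of the images of [f] and [g] under the two inclusions of the factors, which
   are linear and continuous. *)
have c1 : Ck_on k U (fun y => (f y, 0) : W * W').
  apply: (@Ck_on_lin_comp W (W * W')%type (fun w => (w, 0))) cf => //.
    by move=> c a b; apply/pair_equal_spec; rewrite /= scaler0 addr0.
  by move=> x; apply: cvg_pair; [exact: cvg_id | exact: cvg_cst].
have c2 : Ck_on k U (fun y => (0, g y) : W * W').
  apply: (@Ck_on_lin_comp W' (W * W')%type (fun w => (0, w))) cg => //.
    by move=> c a b; apply/pair_equal_spec; rewrite /= scaler0 addr0.
  by move=> x; apply: cvg_pair; [exact: cvg_cst | exact: cvg_id].
apply: Ck_on_ext (Ck_onD oU c1 c2) => // x _.
by apply/pair_equal_spec; rewrite /= addr0 add0r.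
Qed.

Lemma Ck_on_coord m p k U (f : V -> 'M[R]_(m, p)) i j : open U ->
  Ck_on k U f -> Ck_on k U (fun y => f y i j).
Proof.
move=> oU.
apply: (@Ck_on_lin_comp _ _ (fun M : 'M[R]_(m, p) => M i j : R)) => //.
- by move=> c a b; rewrite !mxE.
- exact: coord_continuous.
Qed.

Lemma derive_coord m p (f : V -> 'M[R]_(m, p)) i j x v : differentiable f x ->
  'D_v (fun y => f y i j) x = 'D_v f x i j.
Proof.
move=> df; rewrite derive_mx ?mxE//; exact: diff_derivable.
Qed.

Lemma Ck_on_row p k U (f : V -> 'rV[R]_p) : open U ->
  (forall j, Ck_on k U (fun y => f y 0 j)) -> Ck_on k U f.
Proof.
move=> oU cf.
have := Ck_on_sum (index_enum 'I_p) oU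
  (fun j => Ck_on_scalel (delta_mx 0 j : 'rV[R]_p) oU (cf j)).
apply: Ck_on_ext => // x _.
by rewrite fct_sumE -row_sum_delta.
Qed.

(** * Coordinate formulas for the Dorfman bracket *)

Lemma derive_sum_partials (W : normedModType R) (f : V -> W) x v :
  differentiable f x -> 'D_v f x = \sum_i v 0 i *: 'D_(e i) f x.
Proof.
move=> df; rewrite deriveE// {1}(row_sum_delta v) linear_sum.
by apply: eq_bigr => i _; rewrite linearZ deriveE.
Qed.

Lemma evE (u al : V) : ev u al = \sum_i u 0 i * al 0 i.
Proof. by rewrite /ev mxE; apply: eq_bigr => i _; rewrite mxE. Qed.

Lemma ev_deltal i (al : V) : ev (e i) al = al 0 i.
Proof.
rewrite evE (bigD1 i)//= !mxE !eqxx mul1r big1 ?addr0// => j ji.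
by rewrite !mxE (negPf ji) andbF mul0r.
Qed.

Lemma derive_coord_sum (f : V -> V) x v j : differentiable f x ->
  'D_v f x 0 j = \sum_i v 0 i * 'D_(e i) (fun y => f y 0 j) x.
Proof.
move=> df; rewrite derive_sum_partials// summxE.
by apply: eq_bigr => i _; rewrite mxE derive_coord.
Qed.

(** This formula and the ones below express the brackets through first partial derivatives of scalar
    components. Both the smoothness of the bracket and the polynomial identity behind involutivity
    are stated in these terms. *)
Lemma lie_bracket_coord (X Y : V -> V) x j :
  differentiable X x -> differentiable Y x ->
  lie_bracket X Y x 0 j =
  \sum_i (X x 0 i * 'D_(e i) (fun y => Y y 0 j) x
          - Y x 0 i * 'D_(e i) (fun y => X y 0 j) x).
Proof. by move=> dX dY; rewrite !mxE !derive_coord_sum// -sumrB. Qed.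

Lemma lie_deriv1_coord (X be : V -> V) x j :
  differentiable X x -> differentiable be x ->
  lie_deriv1 X be x 0 j =
  \sum_i (X x 0 i * 'D_(e i) (fun y => be y 0 j) x
          + 'D_(e j) (fun y => X y 0 i) x * be x 0 i).
Proof.
move=> dX db; rewrite mxE ev_deltal derive_coord_sum// evE -big_split /=.
by apply: eq_bigr => i _; rewrite !derive_coord.
Qed.

Lemma contract_d1_coord (Y al : V -> V) x j :
  differentiable al x ->
  contract_d1 Y al x 0 j =
  \sum_i (Y x 0 i * 'D_(e i) (fun y => al y 0 j) x
          - Y x 0 i * 'D_(e j) (fun y => al y 0 i) x).
Proof.
move=> da; rewrite mxE /d1 ev_deltal derive_coord_sum// evE -sumrB.
by apply: eq_bigr => i _; rewrite !derive_coord.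
Qed.

Lemma smooth_on_differentiable (W : normedModType R) U (f : V -> W) x :
  smooth_on U f -> U x -> differentiable f x.
Proof. by move=> /(_ 1%N) [df _]; exact: df. Qed.

Lemma smooth_on_derive (W : normedModType R) U (f : V -> W) v :
  smooth_on U f -> smooth_on U (fun x => 'D_v f x).
Proof. by move=> sf k; have [_ cf] := sf k.+1; exact: cf. Qed.

Lemma dorfman_coord1 (a b : V -> V * V) x j :
  differentiable (fst \o a) x -> differentiable (fst \o b) x ->
  (dorfman a b x).1 0 j =
  \sum_i ((a x).1 0 i * 'D_(e i) (fun y => (b y).1 0 j) x
          - (b x).1 0 i * 'D_(e i) (fun y => (a y).1 0 j) x).
Proof. exact: lie_bracket_coord. Qed.

Lemma dorfman_coord2 (a b : V -> V * V) x j :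
  differentiable (fst \o a) x -> differentiable (snd \o a) x ->
  differentiable (snd \o b) x ->
  (dorfman a b x).2 0 j =
  \sum_i ((a x).1 0 i * 'D_(e i) (fun y => (b y).2 0 j) x
          + (b x).2 0 i * 'D_(e j) (fun y => (a y).1 0 i) x)
  - \sum_i ((b x).1 0 i * 'D_(e i) (fun y => (a y).2 0 j) x
            - (b x).1 0 i * 'D_(e j) (fun y => (a y).2 0 i) x).
Proof.
move=> dX dal dbe.
have -> : (dorfman a b x).2 0 j = lie_deriv1 (fst \o a) (snd \o b) x 0 j
    - contract_d1 (fst \o b) (snd \o a) x 0 j.
  by rewrite [LHS]mxE [X in _ + X]mxE.
rewrite lie_deriv1_coord// contract_d1_coord//.
by congr (_ - _); apply: eq_bigr => i _; rewrite [X in _ + X]mulrC.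
Qed.

(** On [U] each component of the bracket is a combination of products of a component with a first
    partial derivative, and smooth functions are closed under these operations. *)
Lemma smooth_on_dorfman U (a b : V -> V * V) : open U ->
  smooth_on U a -> smooth_on U b -> smooth_on U (dorfman a b).
Proof.
move=> oU sa sb k.
pose c1 (f : V -> V * V) i := fun x => (f x).1 0 i.
pose c2 (f : V -> V * V) i := fun x => (f x).2 0 i.
have s1 f i : smooth_on U f -> smooth_on U (c1 f i).
  by move=> sf l; apply: Ck_on_coord => //; exact: Ck_on_fst.
have s2 f i : smooth_on U f -> smooth_on U (c2 f i).
  by move=> sf l; apply: Ck_on_coord => //; exact: Ck_on_snd.
have d1 f x : smooth_on U f -> U x -> differentiable (fst \o f) x.
  by move=> sf; apply: smooth_on_differentiable => l; exact: Ck_on_fst.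
have d2 f x : smooth_on U f -> U x -> differentiable (snd \o f) x.
  by move=> sf; apply: smooth_on_differentiable => l; exact: Ck_on_snd.
have cM (f g : V -> R) i : smooth_on U f -> smooth_on U g ->
    Ck_on k U (f * 'D_(e i) g).
  by move=> sf sg; apply: Ck_onM => //; exact: smooth_on_derive.
apply: Ck_on_pair => //; apply: Ck_on_row => // j.
  have : Ck_on k U (\sum_i (c1 a i * 'D_(e i) (c1 b j)
                            - c1 b i * 'D_(e i) (c1 a j))).
    by apply: Ck_on_sum => // i; apply: Ck_onB => //; apply: cM; exact: s1.
  apply: Ck_on_ext => // x Ux; rewrite fct_sumE.
  by rewrite -[RHS]/((dorfman a b x).1 0 j) dorfman_coord1//; exact: d1.
have : Ck_on k U (\sum_i (c1 a i * 'D_(e i) (c2 b j)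
                          + c2 b i * 'D_(e j) (c1 a i))
                 - \sum_i (c1 b i * 'D_(e i) (c2 a j)
                           - c1 b i * 'D_(e j) (c2 a i))).
  by apply: Ck_onB => //; apply: Ck_on_sum => // i;
    [apply: Ck_onD => //|apply: Ck_onB => //];
    apply: cM; (exact: s1 || exact: s2).
apply: Ck_on_ext => // x Ux; rewrite !fctE !fct_sumE.
rewrite -[RHS]/((dorfman a b x).2 0 j) dorfman_coord2//;
  (exact: d1 || exact: d2).
Qed.

(** The local frames live on neighbourhoods inside [U], and sections are tested on [U] only. The
    lemma carries the Dirac property from the extended bundle to the graph of [omega]. *)
Lemma dirac_structure_ext U (L L' : V -> {vspace V * V}) :
  (forall x, U x -> L x = L' x) -> dirac_structure U L -> dirac_structure U L'.
Proof.
move=> LL' [[k sL] iL bL].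
have sec (s : V -> V * V) : is_section U L s <-> is_section U L' s.
  by split=> -[ss sLs]; split=> // x Ux; have := sLs x Ux; rewrite LL'.
split.
- exists k => x Ux; have [N [e [oN Nx NU se be]]] := sL x Ux.
  by exists N, e; split=> // y Ny; rewrite -LL'; [exact: be | exact: NU].
- by move=> x Ux; rewrite -LL'//; exact: iL.
- by move=> a b /sec sa /sec sb; apply/sec/bL.
Qed.

End coordinates.

(** * Reduction to the four named coordinates *)

Lemma ord4P (P : 'I_4 -> Prop) :
  P iq1 -> P iq2 -> P ip1 -> P ip2 -> forall i, P i.
Proof.
move=> P0 P1 P2 P3 [[|[|[|[|//]]]] hi].
- by rewrite (_ : Ordinal hi = iq1)//; exact: val_inj.
- by rewrite (_ : Ordinal hi = iq2)//; exact: val_inj.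
- by rewrite (_ : Ordinal hi = ip1)//; exact: val_inj.
- by rewrite (_ : Ordinal hi = ip2)//; exact: val_inj.
Qed.

Lemma big_ord4 (M : nmodType) (F : 'I_4 -> M) :
  \sum_i F i = F iq1 + F iq2 + F ip1 + F ip2.
Proof.
rewrite !big_ord_recr big_ord0 /= add0r.
by congr (F _ + F _ + F _ + F _); exact: val_inj.
Qed.

(** * The extended bundle: frame, equations, maximal isotropy *)

Section monopole.
Variable R : realType.
Local Notation V := 'rV[R]_4.
Local Notation T2 := (V * V)%type.
Implicit Types (x u v : V) (s t : T2) (U : set V).

Definition row4 (a b c d : R) : V := \row_(j < 4) nth 0 [:: a; b; c; d] j.

(* [u] lists the components of [(Y, X_p)]. *)
Definition frame x u : T2 :=
  (row4 (r2 x * u 0 iq1) (r2 x * u 0 iq2) (u 0 ip1) (u 0 ip2),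
   row4 (- u 0 iq2 - u 0 ip1) (u 0 iq1 - u 0 ip2)
     (r2 x * u 0 iq1) (r2 x * u 0 iq2)).

(** Over [Msing] the fibre is spanned by the d/dp_i and the dq^i, so there it is not the graph of a
    2-form. *)
Definition monopole x : {vspace T2} := limg (linfun (frame x)).

Lemma frame_linear x : linear (frame x).
Proof.
move=> c u v; apply/pair_equal_spec.
by split; apply/rowP; apply: ord4P; rewrite !mxE /=; ring.
Qed.

HB.instance Definition _ x :=
  GRing.isLinear.Build R V T2 *:%R (frame x) (frame_linear x).

(** X_p is read off the last two vector components, and then Y off the first two covector
    components. No division by [r2 x] occurs, so the rank stays 4 on [Msing]. *)
Lemma frame_inj x : injective (frame x).
Proof.
move=> u v [/rowP E /rowP F].
have := E ip2; have := E ip1; have := F iq1; have := F iq2.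
rewrite !mxE /= => e1 e2 e3 e4; apply/rowP; apply: ord4P => //; lra.
Qed.

Lemma mem_monopole x s : s \in monopole x <->
  [/\ s.2 0 ip1 = s.1 0 iq1, s.2 0 ip2 = s.1 0 iq2,
      s.1 0 iq1 = r2 x * (s.2 0 iq2 + s.1 0 ip2) &
      s.1 0 iq2 = - r2 x * (s.2 0 iq1 + s.1 0 ip1)].
Proof.
split=> [/memv_imgP[u _ ->]|].
  by rewrite lfunE /=; split; rewrite !mxE /=; ring.
case: s => X al /= [e1 e2 e3 e4].
(* The first two entries are the solution Y of al_q = Y J - X_p. *)
apply/memv_imgP; exists (row4 (al 0 iq2 + X 0 ip2) (- (al 0 iq1 + X 0 ip1))
  (X 0 ip1) (X 0 ip2)); first exact: memvf.
rewrite lfunE /=; apply/pair_equal_spec.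
split; apply/rowP; apply: ord4P; rewrite !mxE /= ?e1 ?e2 ?e3 ?e4; ring.
Qed.

Lemma mem_frame x u : frame x u \in monopole x.
Proof. by apply/memv_imgP; exists u; rewrite ?memvf// lfunE. Qed.

Lemma evE4 u v : ev u v =
  u 0 iq1 * v 0 iq1 + u 0 iq2 * v 0 iq2 + u 0 ip1 * v 0 ip1 + u 0 ip2 * v 0 ip2.
Proof. by rewrite evE big_ord4. Qed.

(** The fibre contains its own orthogonal: the four equations that define it are exactly
    orthogonality to the four frame vectors. Any isotropic space containing the fibre therefore lies
    inside it. *)
Lemma monopole_max_isotropic x : max_isotropic (monopole x).
Proof.
split=> [s t /mem_monopole[s1 s2 s3 s4] /mem_monopole[t1 t2 t3 t4]|W' iW' sub].
  by rewrite /pairing !evE4 s1 s2 s3 s4 t1 t2 t3 t4; ring.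
apply/eqP; rewrite eqEsubv sub andbT; apply/subvP => s sW'.
have orth u : ev s.1 (frame x u).2 + ev (frame x u).1 s.2 = 0.
  have := iW' _ _ sW' (subvP sub _ (mem_frame x u)).
  by move/eqP; rewrite /pairing mulf_eq0 invr_eq0 pnatr_eq0/= => /eqP.
(* The directions [ip1] and [ip2] give al_p = X_q; [iq1] and [iq2] give the equations involving
   [r2 x]. *)
have := orth (dx R ip2); have := orth (dx R ip1).
have := orth (dx R iq2); have := orth (dx R iq1).
rewrite !evE4 !mxE /= => o1 o2 o3 o4.
by apply/mem_monopole; split; lra.
Qed.

Lemma frame_basis x :
  basis_of (monopole x) [seq frame x (delta_mx 0 i) | i : 'I_4].
Proof.
have -> : [seq frame x (delta_mx 0 i) | i : 'I_4] =
    map (linfun (frame x)) [seq (delta_mx 0 i : V) | i : 'I_4].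
  by rewrite -map_comp; apply: eq_map => i /=; rewrite lfunE.
apply: limg_basis_of (basis_of_delta R 4).
apply/eqP; rewrite capfv; apply/lker0P => u v.
by rewrite !lfunE; exact: frame_inj.
Qed.

(** * Smoothness of the frame and derivatives of r^2 *)

Lemma Ck_on_coordinate k U (i : 'I_4) : Ck_on k U (fun x : V => x 0 i).
Proof.
have lin : linear (fun x : V => x 0 i : R) by move=> c u v; rewrite !mxE.
pose m := GRing.isLinear.Build _ _ _ _ (fun x : V => x 0 i : R) lin.
pose L : {linear V -> R} := HB.pack (fun x : V => x 0 i : R) m.
by apply: (@Ck_on_linear R 4 _ L); exact: coord_continuous.
Qed.

Lemma Ck_on_r2 k U : open U -> Ck_on k U (@r2 R).
Proof.
move=> oU; have cc i : Ck_on k U (fun x : V => x 0 i).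
  exact: Ck_on_coordinate.
by apply: Ck_on_ext (Ck_onD oU (Ck_onM oU (cc iq1) (cc iq1))
  (Ck_onM oU (cc iq2) (cc iq2))).
Qed.

Lemma frame_smooth U u : open U -> smooth_on U (frame^~ u).
Proof.
move=> oU k.
have cZ c : Ck_on k U (fun x => r2 x * c).
  apply: (@Ck_onM _ _ _ _ (@r2 R) (cst c)) => //.
    exact: Ck_on_r2.
  exact: Ck_on_cst.
by apply: Ck_on_pair => //; apply: Ck_on_row => //; apply: ord4P => /=;
  under eq_fun do rewrite mxE /=; (exact: cZ || exact: Ck_on_cst).
Qed.

Lemma differentiable_coordinate (i : 'I_4) x :
  differentiable (fun y : V => y 0 i) x.
Proof. exact: differentiable_coord. Qed.

Lemma derive_coordinate (i : 'I_4) x v : 'D_v (fun y : V => y 0 i) x = v 0 i.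
Proof. by rewrite derive_coord ?derive_id//; exact: ex_diff. Qed.

Lemma derive_r2 x v :
  'D_v (@r2 R) x = 2 * (x 0 iq1 * v 0 iq1 + x 0 iq2 * v 0 iq2).
Proof.
pose c i (y : V) : R := y 0 i.
have d i : derivable (c i) x v.
  exact/diff_derivable/differentiable_coordinate.
have dM i : derivable (c i * c i) x v := derivableM (d i) (d i).
have -> : @r2 R = c iq1 * c iq1 + c iq2 * c iq2.
  by apply/funext => y; rewrite /r2 !expr2.
rewrite (deriveD (dM _) (dM _)) (deriveM (d iq1) (d iq1)).
rewrite (deriveM (d iq2) (d iq2)) !derive_coordinate /GRing.scale /= /c; ring.
Qed.

Lemma derive_r2M (f : V -> R) x v : differentiable f x ->
  'D_v (fun y => r2 y * f y) x = r2 x * 'D_v f x + 'D_v (@r2 R) x * f x.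
Proof.
move=> df; rewrite (@deriveM _ _ (@r2 R) f).
- by rewrite /GRing.scale /= [X in _ + X]mulrC.
- apply/diff_derivable/(Ck_on_differentiable (k := 0) (U := setT)) => //.
  exact/Ck_on_r2/openT.
- exact: diff_derivable.
Qed.

(** * Sections of the bundle and involutivity *)

Lemma section_coord U (s : V -> T2) x : is_section U monopole s -> U x ->
  [/\ (s x).2 0 ip1 = (s x).1 0 iq1, (s x).2 0 ip2 = (s x).1 0 iq2,
      (s x).1 0 iq1 = r2 x * ((s x).2 0 iq2 + (s x).1 0 ip2) &
      (s x).1 0 iq2 = - r2 x * ((s x).2 0 iq1 + (s x).1 0 ip1)].
Proof. by move=> sec Ux; apply/mem_monopole/sec.2. Qed.

(** The two sides of each equation agree near [x], as [U] is open, and so have the same derivative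
    there; the product rule contributes the terms in ['D_v (@r2 R) x]. *)
Lemma section_derive U (s : V -> T2) x v :
  open U -> is_section U monopole s -> U x ->
  [/\ 'D_v (fun y => (s y).2 0 ip1) x = 'D_v (fun y => (s y).1 0 iq1) x,
      'D_v (fun y => (s y).2 0 ip2) x = 'D_v (fun y => (s y).1 0 iq2) x,
      'D_v (fun y => (s y).1 0 iq1) x =
        r2 x * ('D_v (fun y => (s y).2 0 iq2) x
                + 'D_v (fun y => (s y).1 0 ip2) x)
        + 'D_v (@r2 R) x * ((s x).2 0 iq2 + (s x).1 0 ip2) &
      'D_v (fun y => (s y).1 0 iq2) x =
        - r2 x * ('D_v (fun y => (s y).2 0 iq1) x
                  + 'D_v (fun y => (s y).1 0 ip1) x)
        - 'D_v (@r2 R) x * ((s x).2 0 iq1 + (s x).1 0 ip1)].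
Proof.
move=> oU sec Ux; have [smooth_s _] := sec.
have d1 i : differentiable (fun y => (s y).1 0 i) x.
  apply: (@smooth_on_differentiable R 4 _ U) => // k.
  by apply: Ck_on_coord => //; exact: Ck_on_fst.
have d2 i : differentiable (fun y => (s y).2 0 i) x.
  apply: (@smooth_on_differentiable R 4 _ U) => // k.
  by apply: Ck_on_coord => //; exact: Ck_on_snd.
split.
- by apply/near_eq_derive/(open_near_eq oU) => // y /(section_coord sec)[].
- by apply/near_eq_derive/(open_near_eq oU) => // y /(section_coord sec)[].
- transitivity ('D_v (fun y => r2 y *
      ((fun y => (s y).2 0 iq2) + (fun y => (s y).1 0 ip2)) y) x).
    by apply/near_eq_derive/(open_near_eq oU) => // y /(section_coord sec)[].
  rewrite derive_r2M; last exact: differentiableD.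
  by rewrite deriveD//; exact: diff_derivable.
(* The sign is moved onto the second factor so that [derive_r2M] applies. *)
- transitivity ('D_v (fun y => r2 y *
      (- ((fun y => (s y).2 0 iq1) + (fun y => (s y).1 0 ip1))) y) x).
    apply/near_eq_derive/(open_near_eq oU) => // y.
    move=> /(section_coord sec)[_ _ _ ->].
    by rewrite mulNr -mulrN.
  rewrite derive_r2M; last exact/differentiableN/differentiableD.
  rewrite deriveN; last exact/diff_derivable/differentiableD.
  by rewrite deriveD ?mulrN ?mulNr//; exact: diff_derivable.
Qed.

(** Values and partial derivatives at one point become independent scalars: [DX i j] stands for the
    i-th partial derivative of X^j, [r] for r^2 and [Dr] for its gradient. The vanishing of [Dr]
    along the fibres encodes that a function of q times dq^1 ^ dq^2 is closed. *)
Lemma dorfman_monopole_identity (X al Y be : 'I_4 -> R)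
    (DX Dal DY Dbe : 'I_4 -> 'I_4 -> R) (r : R) (Dr : 'I_4 -> R) :
  let bX j := \sum_i (X i * DY i j - Y i * DX i j) in
  let bal j := \sum_i (X i * Dbe i j + be i * DX j i)
              - \sum_i (Y i * Dal i j - Y i * Dal j i) in
  Dr ip1 = 0 -> Dr ip2 = 0 ->
  [/\ al ip1 = X iq1, al ip2 = X iq2,
      X iq1 = r * (al iq2 + X ip2) & X iq2 = - r * (al iq1 + X ip1)] ->
  [/\ be ip1 = Y iq1, be ip2 = Y iq2,
      Y iq1 = r * (be iq2 + Y ip2) & Y iq2 = - r * (be iq1 + Y ip1)] ->
  (forall i, [/\ Dal i ip1 = DX i iq1, Dal i ip2 = DX i iq2,
      DX i iq1 = r * (Dal i iq2 + DX i ip2) + Dr i * (al iq2 + X ip2) &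
      DX i iq2 = - r * (Dal i iq1 + DX i ip1) - Dr i * (al iq1 + X ip1)]) ->
  (forall i, [/\ Dbe i ip1 = DY i iq1, Dbe i ip2 = DY i iq2,
      DY i iq1 = r * (Dbe i iq2 + DY i ip2) + Dr i * (be iq2 + Y ip2) &
      DY i iq2 = - r * (Dbe i iq1 + DY i ip1) - Dr i * (be iq1 + Y ip1)]) ->
  [/\ bal ip1 = bX iq1, bal ip2 = bX iq2,
      bX iq1 = r * (bal iq2 + bX ip2) & bX iq2 = - r * (bal iq1 + bX ip1)].
Proof.
move=> bX bal r1 r2 [A1 A2 A3 A4] [B1 B2 B3 B4] DA DB.
have a1 i : Dal i ip1 = DX i iq1 by case: (DA i).
have a2 i : Dal i ip2 = DX i iq2 by case: (DA i).
have a3 i : DX i iq1 = r * (Dal i iq2 + DX i ip2) + Dr i * (al iq2 + X ip2).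
  by case: (DA i).
have a4 i : DX i iq2 = - r * (Dal i iq1 + DX i ip1) - Dr i * (al iq1 + X ip1).
  by case: (DA i).
have b1 i : Dbe i ip1 = DY i iq1 by case: (DB i).
have b2 i : Dbe i ip2 = DY i iq2 by case: (DB i).
have b3 i : DY i iq1 = r * (Dbe i iq2 + DY i ip2) + Dr i * (be iq2 + Y ip2).
  by case: (DB i).
have b4 i : DY i iq2 = - r * (Dbe i iq1 + DY i ip1) - Dr i * (be iq1 + Y ip1).
  by case: (DB i).
(* Covector p-components are first renamed to vector q-components, which are then eliminated, for
   derivatives before values. What remains is free in al_q, X_p, be_q, Y_p, their derivatives, [r]
   and the q-part of [Dr]. *)
by split; rewrite /bX /bal !big_ord4 ?(a1, a2, b1, b2) ?(a3, a4, b3, b4)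
  ?(A1, A2, B1, B2) ?(A3, A4, B3, B4) ?(r1, r2); ring.
Qed.

Lemma monopole_involutive U a b : open U ->
  is_section U monopole a -> is_section U monopole b ->
  is_section U monopole (dorfman a b).
Proof.
move=> oU sa sb; split; first exact: smooth_on_dorfman sa.1 sb.1.
move=> x Ux; apply/mem_monopole.
have d1 (s : V -> T2) : is_section U monopole s -> differentiable (fst \o s) x.
  move=> [ss _]; apply: (@smooth_on_differentiable R 4 _ U) => // k.
  exact: Ck_on_fst.
have d2 (s : V -> T2) : is_section U monopole s -> differentiable (snd \o s) x.
  move=> [ss _]; apply: (@smooth_on_differentiable R 4 _ U) => // k.
  exact: Ck_on_snd.
rewrite !(dorfman_coord1 _ (d1 a sa) (d1 b sb)).
rewrite !(dorfman_coord2 _ (d1 a sa) (d2 a sa) (d2 b sb)).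
apply: (dorfman_monopole_identity
  (Dr := fun i => 'D_(delta_mx 0 i) (@r2 R) x)
  (X := fun i => (a x).1 0 i) (al := fun i => (a x).2 0 i)
  (Y := fun i => (b x).1 0 i) (be := fun i => (b x).2 0 i)
  (DX := fun i j => 'D_(delta_mx 0 i) (fun y => (a y).1 0 j) x)
  (Dal := fun i j => 'D_(delta_mx 0 i) (fun y => (a y).2 0 j) x)
  (DY := fun i j => 'D_(delta_mx 0 i) (fun y => (b y).1 0 j) x)
  (Dbe := fun i j => 'D_(delta_mx 0 i) (fun y => (b y).2 0 j) x)).
- by rewrite derive_r2 !mxE /=; ring.
- by rewrite derive_r2 !mxE /=; ring.
- exact: section_coord Ux.
- exact: section_coord Ux.
- by move=> i; exact: section_derive Ux.
- by move=> i; exact: section_derive Ux.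
Qed.

(** The open set is arbitrary because two cases are needed: the whole space for the extension, and
    the complement of [Msing] for the graph. *)
Lemma monopole_dirac U : open U -> dirac_structure U monopole.
Proof.
move=> oU; split; last by move=> a b; exact: monopole_involutive.
  exists 4%N => x Ux; exists U, (fun i => frame^~ (delta_mx 0 i)).
  by split=> // [i|y _]; [exact: frame_smooth | exact: frame_basis].
by move=> x _; exact: monopole_max_isotropic.
Qed.

(** * Comparison with the graph of the magnetic form *)

Lemma notMsingE : ~` @Msing R = [set x | r2 x != 0].
Proof.
apply/seteqP; split=> x /=; rewrite /r2 paddr_eq0 ?sqr_ge0// !sqrf_eq0.
  by move=> nM; apply/negP => /andP[/eqP ? /eqP ?]; exact: nM.
by move=> nM [h1 h2]; move: nM; rewrite h1 h2 eqxx.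
Qed.

Lemma open_notMsing : open (~` @Msing R).
Proof.
rewrite notMsingE; apply: (@open_comp _ _ (@r2 R) [set y | y != 0]).
  by move=> x _; apply: (Ck_on_r2 0 openT).
exact: open_neq.
Qed.

Lemma ev_dx u i : ev u (dx R i) = u 0 i.
Proof.
rewrite evE (bigD1 i)//= mxE !eqxx mulr1 big1 ?addr0// => j ji.
by rewrite mxE (negPf ji) andbF mulr0.
Qed.

Lemma mul_wedge u (al be : V) :
  u *m wedge al be = ev u al *: be - ev u be *: al.
Proof.
rewrite /wedge mulmxBr !mulmxA.
by rewrite [u *m al^T]mx11_scalar [u *m be^T]mx11_scalar !mul_scalar_mx.
Qed.

Lemma mul_omega x u : u *m omega x = row4
  (- u 0 ip1 - (r2 x)^-1 * u 0 iq2) (- u 0 ip2 + (r2 x)^-1 * u 0 iq1)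
  (u 0 iq1) (u 0 iq2).
Proof.
rewrite /omega 2!mulmxDr -scalemxAr !mul_wedge !ev_dx.
by apply/rowP; apply: ord4P; rewrite !mxE /=; ring.
Qed.

(** Off [Msing] the factor [r2 x] is invertible, so X_q J = r^2 (al_q + X_p) can be solved for al_q,
    which gives the covector i_X omega. *)
Lemma monopole_graph x : (~` @Msing R) x -> monopole x = graph (@omega R) x.
Proof.
rewrite notMsingE /= => r0; apply/vspaceP => s.
rewrite mem_graph mul_omega; apply/idP/eqP.
  case/mem_monopole => e1 e2 e3 e4.
  (* Rewriting with [e1] and [e2] brings back components of X_q, hence the second pass of [e3] and
     [e4]. *)
  apply/rowP; apply: ord4P; rewrite !mxE /= ?e3 ?e4 ?e1 ?e2 ?e3 ?e4//;
  by field.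
move=> sE; apply/mem_monopole; rewrite sE !mxE /=; split=> //; by field.
Qed.

(** * Smoothness and closedness of the magnetic form *)

Lemma wedge_bilin u v (al be : V) :
  (u *m wedge al be *m v^T) 0 0 = ev u al * ev v be - ev u be * ev v al.
Proof.
by rewrite mul_wedge -/(ev _ v) [LHS]evE4 (evE4 v be) (evE4 v al) !mxE; ring.
Qed.

Lemma omega_smooth : smooth_on (~` @Msing R) (@omega R).
Proof.
move=> k; apply: Ck_onD; [exact: open_notMsing|exact: Ck_on_cst|].
apply: Ck_on_scalel; first exact: open_notMsing.
apply: Ck_onV; first exact: open_notMsing.
- by rewrite notMsingE.
- exact/Ck_on_r2/open_notMsing.
Qed.

Lemma derive_omega x v : (~` @Msing R) x ->
  'D_v (@omega R) x =
  - ((r2 x) ^- 2 * 'D_v (@r2 R) x) *: wedge (dx R iq1) (dx R iq2).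
Proof.
rewrite notMsingE /= => r0.
have dr : differentiable (@r2 R) x.
  apply/(Ck_on_differentiable (k := 0) (U := setT)) => //.
  exact/Ck_on_r2/openT.
have dV : differentiable (fun y => (r2 y)^-1) x by exact: differentiableV.
pose w : 'M[R]_4 := wedge (dx R iq1) (dx R iq2).
have dw : differentiable (fun y => (r2 y)^-1 *: w) x by exact: differentiableZl.
have -> : @omega R =
    cst (wedge (dx R iq1) (dx R ip1) + wedge (dx R iq2) (dx R ip2)) +
    (fun y => (r2 y)^-1 *: w) by [].
rewrite deriveD; [|exact: derivable_cst|exact: diff_derivable].
rewrite derive_cst add0r.
rewrite (@derive_lin_comp _ _ _ _ (fun c : R => c *: w)) //.
- rewrite deriveV//; last exact: diff_derivable.
  by rewrite [X in X *: _]mulNr.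
- by move=> c a b; rewrite scalerDl scalerA.
- exact: scalel_continuous.
Qed.

(** Only the magnetic term varies, so d omega = d(r^-2) ^ dq^1 ^ dq^2. This vanishes because d(r^2)
    is a combination of dq^1 and dq^2. *)
Lemma omega_closed : closed_two_form (~` @Msing R) (@omega R).
Proof.
split; first split; first exact: omega_smooth.
  by move=> x _ u; rewrite mul_omega -/(ev _ u) evE4 !mxE /=; ring.
move=> x Mx u v w; rewrite /d2 !derive_omega// -!scalemxAr -!scalemxAl.
have cE c (A : 'M[R]_1) : (c *: A) 0 0 = c * A 0 0 by rewrite mxE.
by rewrite !cE !wedge_bilin !ev_dx !derive_r2; ring.
Qed.

End monopole.

Theorem proposition2p5 (R : realType) :
  [/\ closed_two_form (~` @Msing R) (@omega R),
      dirac_structure (~` @Msing R) (graph (@omega R)) &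
      exists L : 'rV[R]_4 -> {vspace ('rV[R]_4 * 'rV[R]_4)%type},
        dirac_structure setT L /\
        forall x, (~` @Msing R) x -> L x = graph (@omega R) x].
Proof.
split; first exact: omega_closed.
- apply: dirac_structure_ext (@monopole_graph R) _.
  exact/monopole_dirac/open_notMsing.
- exists (@monopole R); split; last exact: monopole_graph.
  exact/monopole_dirac/openT.
Qed.
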